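(* The Catalan pellytope $\mathcal P_{n,n}$ is unimodularly equivalent to the associahedron $\operatorname{Ass}_n$.
   Context: Let $n\ge1$. For $1\le k\le n$ and $1\le j\le n-k+1$ let $q_{k,j}=1+y_j+y_jy_{j+1}+\cdots+y_jy_{j+1}\cdots y_{j+k-1}$, and let $\mathcal P_{n,n}=\operatorname{Newt}\bigl(\prod_{k=1}^{n}\prod_{j=1}^{n-k+1}q_{k,j}\bigr)\subset\mathbb R^n$. The (Loday realization of the) associahedron is $\operatorname{Ass}_n=\operatorname{Newt}\bigl(\prod_{0\le i\le j\le n}(t_i+t_{i+1}+\cdots+t_j)\bigr)\subset\mathbb R^{n+1}$, where the Newton polytope is taken with respect to the variables $t_0,\dots,t_n$. Two lattice polytopes are unimodularly equivalent if, up to translation by a lattice vector, a lattice isomorphism sends one to the other; here the lattices are $\mathbb Z^n$ and $A_n=\{a\in\mathbb Z^{n+1}:\sum_{i=0}^n a_i=0\}$ (a translate of $\operatorname{Ass}_n$ by a vector of $\mathbb Z^{n+1}$ lies in $A_n\otimes\mathbb R$). *)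

(* Defs.v *)
From HB Require Import structures.
From mathcomp Require Export all_boot all_order all_algebra.
From mathcomp Require Export mpoly.
From mathcomp Require Export classical_sets functions cardinality reals convex.

Set Implicit Arguments.
Unset Strict Implicit.
Unset Printing Implicit Defensive.

Import Order.TTheory GRing.Theory Num.Theory.

Local Open Scope classical_set_scope.
Local Open Scope ring_scope.

Definition conv_hull (R : realType) (V : lmodType R) (A : set V) : set V :=
  smallest (@convex_set R V) A.

Definition lattice_polytope (R : realType) (V : lmodType R)
    (L P : set V) : Prop :=
  exists S : set V, [/\ finite_set S, S `<=` L & P = conv_hull S].

Definition translate (R : realType) (V : lmodType R) (w : V) (P : set V) :
  set V := [set x + w | x in P].

(* [f] stands for the R-linear extension of a group isomorphism [L -> M]; only
   its values on the span of [L] matter, and any linear map defined on that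
   span extends to [V]. *)
Definition unimodularly_equivalent (R : realType) (V W : lmodType R)
    (L : set V) (M : set W) (P : set V) (Q : set W) : Prop :=
  [/\ lattice_polytope L P, lattice_polytope M Q &
      exists (f : {linear V -> W}) (v : W),
        [/\ set_bij L M f, M v & Q = translate v (f @` P)]].

Definition latticeZ (R : realType) (n : nat) : set 'rV[R]_n :=
  [set a | forall i, a 0 i \is a Num.int].
Arguments latticeZ R n : clear implicits.

Definition latticeA (R : realType) (n : nat) : set 'rV[R]_n.+1 :=
  [set a | latticeZ R n.+1 a /\ \sum_i a 0 i = 0].
Arguments latticeA R n : clear implicits.

Definition exponent (R : realType) (n : nat) (m : 'X_{1..n}) : 'rV[R]_n :=
  \row_i (m i)%:R.

Definition Newt (R : realType) (n : nat) (p : {mpoly R[n]}) : set 'rV[R]_n :=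
  conv_hull [set exponent R m | m in [set` msupp p]].

(* The variables are 1-based on paper: y_{i+1} is ['X_i], so the l-th summand
   is y_j y_{j+1} ... y_{j+l-1}, equal to 1 when l = 0. *)
Definition q (R : realType) (n k j : nat) : {mpoly R[n]} :=
  \sum_(l < k.+1) \prod_(i < n | (j <= i.+1 < j + l)%N) 'X_i.

Definition catalan_pellytope (R : realType) (n : nat) : set 'rV[R]_n :=
  Newt (\prod_(1 <= k < n.+1) \prod_(1 <= j < (n - k + 1).+1) q R n k j).
Arguments catalan_pellytope R n : clear implicits.

Definition Ass (R : realType) (n : nat) : set 'rV[R]_n.+1 :=
  Newt (\prod_(i < n.+1) \prod_(j < n.+1 | (i <= j)%N)
          \sum_(l < n.+1 | (i <= l <= j)%N) ('X_l : {mpoly R[n.+1]})).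
Arguments Ass R n : clear implicits.

(* Main.v *)
Require Import Defs.
From mathcomp Require Import zify.

Set Implicit Arguments.
Unset Strict Implicit.
Unset Printing Implicit Defensive.

Import Order.TTheory GRing.Theory Num.Theory.

Local Open Scope classical_set_scope.
Local Open Scope ring_scope.

(** Substitute y_m = t_m / t_(m-1).  The product y_(i+1) ... y_(i+l) telescopes
to t_(i+l) / t_i, so that

  t_i + t_(i+1) + ... + t_j = t_i * q_(j-i, i+1)(y).

Multiplying over all 0 <= i <= j <= n turns the polynomial of the Catalan
pellytope into that of the associahedron, up to the monomial prod_i t_i^(n+1-i)
(the factors with i = j are single variables and match q_(0, i+1) = 1).
On exponents the substitution is the linear map f sending the m-th basis vector
to e_m - e_(m-1), and the extra monomial is a translation by an integer
vector c.  As f is a bijection from Z^n onto A_n ([diff_mx_bij]), translating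
the associahedron by -c gives exactly the image of the pellytope under f.

The substitution lands in Laurent polynomials, so it is not applied to
polynomials directly.  Instead [affinely_related f c p p'] records that the
exponents of p' are the image of those of p under x |-> f x + c.  When all
coefficients are nonnegative no cancellation occurs: the support of a sum is
the union of the supports and the support of a product is their Minkowski sum
([exponentsD], [exponentsM]).  Hence the relation passes to sums and products,
and it suffices to check it on the monomials of each factor
([affinely_related_factor]).  Convex hulls commute with affine maps
([conv_hull_affine]), which transfers the result to Newton polytopes. *)

(** * Convex hulls and affine maps *)

(** Both inclusions use minimality of the hull: the image of a convex set under
an affine map is convex, and so is the preimage. *)
Lemma conv_hull_affine (R : realType) (V W : lmodType R)
    (f : {linear V -> W}) (c : W) (S : set V) :
  conv_hull [set f x + c | x in S] = [set f x + c | x in conv_hull S].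
Proof.
have faff (x y : convex_lmodType V) l :
  f (conv l x y) + c =
    conv l (f x + c : convex_lmodType W) (f y + c : convex_lmodType W).
  rewrite /conv /= linearD !linearZ /= !scalerDr addrACA -scalerDl.
  by rewrite [X in X *: c](_ : _ = 1) ?scale1r // addrC subrK.
apply/seteqP; split.
- apply: smallest_sub => [x y l|].
    rewrite !in_setE => -[u Su <-] [v Sv <-].
    exists (conv l (u : convex_lmodType V) v); last exact: faff.
    move=> A [Aconv SA]; rewrite -in_setE.
    by apply: (Aconv); rewrite in_setE; [apply: Su | apply: Sv].
  by move=> _ [x Sx <-]; exists x => //; apply: sub_gen_smallest.
- move=> _ [x Sx <-].
  apply: (Sx [set x | conv_hull [set f x + c | x in S] (f x + c)]).
  split=> [u v l|u Su]; last first.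
    by apply: sub_gen_smallest; exists u.
  rewrite !in_setE /= faff => Su Sv A [Aconv SA]; rewrite -in_setE.
  by apply: (Aconv); rewrite in_setE; [apply: Su | apply: Sv].
Qed.

(** * Supports of polynomials with nonnegative coefficients *)

Definition nneg_coef (R : realType) (n : nat) (p : {mpoly R[n]}) : Prop :=
  forall m, 0 <= p@_m.

Lemma nneg_coefM (R : realType) (n : nat) (p p' : {mpoly R[n]}) :
  nneg_coef p -> nneg_coef p' -> nneg_coef (p * p').
Proof.
by move=> p0 p'0 m; rewrite mcoeffM; apply: sumr_ge0 => k _; apply: mulr_ge0.
Qed.

Definition exponents (R : realType) (n : nat) (p : {mpoly R[n]}) :
  set 'rV[R]_n := [set exponent R m | m in [set` msupp p]].

Lemma exponentD (R : realType) (n : nat) (m m' : 'X_{1..n}) :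
  exponent R (m + m')%MM = exponent R m + exponent R m'.
Proof. by apply/rowP => i; rewrite !mxE mnmDE natrD. Qed.

Lemma exponentsX (R : realType) (n : nat) (m : 'X_{1..n}) :
  exponents ('X_[m] : {mpoly R[n]}) = [set exponent R m].
Proof.
rewrite /exponents msuppX -[X in _ = X]image_set1; congr image.
by apply/seteqP; split=> k; rewrite /= mem_seq1 => /eqP.
Qed.

(** A sum of two nonnegative coefficients vanishes only if both do, so no
monomial cancels. *)
Lemma exponentsD (R : realType) (n : nat) (p p' : {mpoly R[n]}) :
  nneg_coef p -> nneg_coef p' ->
  exponents (p + p') = exponents p `|` exponents p'.
Proof.
move=> p0 p'0; rewrite /exponents -image_setU; congr image.
apply/seteqP; split=> m /=; rewrite !mcoeff_msupp mcoeffD paddr_eq0 // negb_and.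
  by move/orP.
by move=> ?; apply/orP.
Qed.

(** Each coefficient of the product is a sum of nonnegative terms, and the term
coming from a pair of monomials of the two factors is positive. *)
Lemma exponentsM (R : realType) (n : nat) (p p' : {mpoly R[n]}) :
  nneg_coef p -> nneg_coef p' ->
  exponents (p * p') = [set x + y | x in exponents p & y in exponents p'].
Proof.
move=> p0 p'0; apply/seteqP; split=> [_ [m /msuppM_le mpp' <-]|].
  have /allpairsP[[m1 m2] /= [m1p m2p' ->]] := mpp'.
  by exists (exponent R m1); [exists m1 | exists (exponent R m2);
    [exists m2 | rewrite exponentD]].
move=> _ [_ [m1 /= m1p <-] [_ [m2 /= m2p' <-] <-]].
exists (m1 + m2)%MM; last exact: exponentD.
rewrite /= mcoeff_msupp mcoeffM psumr_neq0; last first.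
  by move=> k _; apply: mulr_ge0.
have m1lt : (mdeg m1 < (mdeg (m1 + m2)).+1)%N by rewrite ltnS mdegD leq_addr.
have m2lt : (mdeg m2 < (mdeg (m1 + m2)).+1)%N by rewrite ltnS mdegD leq_addl.
apply/hasP; exists (BMultinom m1lt, BMultinom m2lt) => /=.
  by rewrite mem_index_enum.
by rewrite eqxx mulr_gt0 // lt_def -mcoeff_msupp ?m1p ?m2p' ?p0 ?p'0.
Qed.

(** * Affinely related supports *)

(** Nonnegativity is part of the relation because only then do supports of sums
and products depend on the supports alone. *)
Definition affinely_related (R : realType) (n m : nat)
    (f : {linear 'rV[R]_n -> 'rV[R]_m}) (c : 'rV[R]_m)
    (p : {mpoly R[n]}) (p' : {mpoly R[m]}) : Prop :=
  [/\ nneg_coef p, nneg_coef p' &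
      exponents p' = [set f x + c | x in exponents p]].

Section AffinelyRelated.
Context (R : realType) (n m : nat) (f : {linear 'rV[R]_n -> 'rV[R]_m}).
Implicit Types (c d : 'rV[R]_m) (p q : {mpoly R[n]}) (u v : {mpoly R[m]}).

Lemma affinely_related0 c : affinely_related f c 0 0.
Proof.
split=> [k|k|]; rewrite ?mcoeff0 // /exponents !msupp0.
by rewrite !set_nil !image_set0.
Qed.

Lemma affinely_relatedX c (a : 'X_{1..n}) (b : 'X_{1..m}) :
  exponent R b = f (exponent R a) + c -> affinely_related f c 'X_[a] 'X_[b].
Proof.
move=> ab; split=> [k|k|]; rewrite ?mcoeffX ?ler0n //.
by rewrite !exponentsX image_set1 ab.
Qed.

Lemma affinely_related1 : affinely_related f 0 1 1.
Proof.
rewrite -!mpolyX0; apply: affinely_relatedX; rewrite addr0.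
have e0 k : exponent R (0%MM : 'X_{1..k}) = 0.
  by apply/rowP => i; rewrite !mxE mnm0E.
by rewrite !e0 linear0.
Qed.

(** The translation vector has to be the same for both summands; in a product
the translations add up instead. *)
Lemma affinely_relatedD c p q u v :
  affinely_related f c p u -> affinely_related f c q v ->
  affinely_related f c (p + q) (u + v).
Proof.
move=> [p0 u0 pE] [q0 v0 qE]; split=> [k|k|]; rewrite ?mcoeffD ?addr_ge0 //.
by rewrite !exponentsD // pE qE image_setU.
Qed.

Lemma affinely_relatedM c d p q u v :
  affinely_related f c p u -> affinely_related f d q v ->
  affinely_related f (c + d) (p * q) (u * v).
Proof.
move=> [p0 u0 pE] [q0 v0 qE]; split; rewrite ?exponentsM //;
  try exact: nneg_coefM.
rewrite pE qE; apply/seteqP; split.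
  move=> _ [_ [x px <-] [_ [y qy <-] <-]].
  by exists (x + y); [exists x => //; exists y | rewrite linearD addrACA].
move=> _ [_ [x px [y qy <-]] <-].
exists (f x + c); first by exists x.
by exists (f y + d); [exists y | rewrite linearD addrACA].
Qed.

End AffinelyRelated.

(** * The lattice isomorphism between Z^n and A_n *)

(** Row vectors multiply on the left, so row i is the exponent vector
e_(i+1) - e_i of t_(i+1) / t_i. *)
Definition diff_mx (R : realType) (n : nat) : 'M[R]_(n, n.+1) :=
  \matrix_(i < n, l < n.+1) ((l == i.+1 :> nat)%:R - (l == i :> nat)%:R).
Arguments diff_mx R n : clear implicits.

(** Partial sums invert differences: a *m tail_mx lists the tail sums of a. *)
Definition tail_mx (R : realType) (n : nat) : 'M[R]_(n.+1, n) :=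
  \matrix_(l < n.+1, i < n) (i < l)%N%:R.
Arguments tail_mx R n : clear implicits.

Lemma sum_pick (R : pzRingType) (n k : nat) (F : nat -> R) :
  \sum_(l < n) ((l == k :> nat)%:R * F l) = (k < n)%N%:R * F k.
Proof.
have [kn|nk] := ltnP k n.
  rewrite (bigD1 (Ordinal kn)) //= eqxx big1 ?addr0 // => l.
  by rewrite -val_eqE /= => /negPf->; rewrite mul0r.
rewrite mul0r big1 // => l _; case: eqP => [lk|_]; last by rewrite mul0r.
by have := ltn_ord l; rewrite lk ltnNge nk.
Qed.

Lemma mul_diff_tail (R : realType) (n : nat) :
  diff_mx R n *m tail_mx R n = 1%:M.
Proof.
apply/matrixP => i j; rewrite !mxE.
under eq_bigr => l _ do rewrite !mxE mulrBl.
rewrite sumrB !(sum_pick _ _ (fun l => (j < l)%N%:R)).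
rewrite !ltnS (ltn_ord i) (ltnW (ltn_ord i)) !mul1r -val_eqE /= leq_eqVlt eq_sym.
by case: ltngtP => _; rewrite ?subrr ?subr0.
Qed.

(** The error term sends a to (sum of a) * e_0, which is why [tail_mx] inverts
[diff_mx] on the right exactly on the hyperplane of sum zero. *)
Lemma mul_tail_diff (R : realType) (n : nat) :
  tail_mx R n *m diff_mx R n =
    1%:M - \matrix_(l < n.+1, k < n.+1) (k == 0 :> nat)%:R.
Proof.
apply/matrixP => l k; rewrite !mxE.
under eq_bigr => i _ do rewrite !mxE mulrC mulrBl.
rewrite sumrB -val_eqE /=.
have -> : \sum_(i < n) (k == i :> nat)%:R * (i < l)%N%:R =
    (k < l)%N%:R :> R.
  under eq_bigr => i _ do rewrite eq_sym.
  rewrite (sum_pick _ _ (fun i => (i < l)%N%:R)) -natrM mulnb.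
  case: (ltnP k l) => [kl|]; last by rewrite andbF.
  by rewrite (leq_trans kl) // -ltnS ltn_ord.
case: (val k) (ltn_ord k) => [|k'] k'n.
  rewrite big1 ?sub0r => [|i _]; last by rewrite mul0r.
  by case: (nat_of_ord l) => [|l'] /=; rewrite ?oppr0 ?subrr ?sub0r.
under eq_bigr => i _ do rewrite eqSS eq_sym.
rewrite (sum_pick _ _ (fun i => (i < l)%N%:R)) -ltnS k'n mul1r subr0.
by case: (ltngtP k'.+1 l) => _; rewrite ?subrr ?subr0.
Qed.

Lemma latticeZ_mulmx (R : realType) (n m : nat) (x : 'rV[R]_n)
    (M : 'M[R]_(n, m)) :
  latticeZ R n x -> (forall i j, M i j \is a Num.int) -> latticeZ R m (x *m M).
Proof.
by move=> xZ MZ j; rewrite mxE; apply: rpred_sum => i _; apply: rpredM.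
Qed.

Lemma diff_mx_int (R : realType) (n : nat) i l :
  diff_mx R n i l \is a Num.int.
Proof. by rewrite mxE rpredB ?natr_int. Qed.

Lemma tail_mx_int (R : realType) (n : nat) l i :
  tail_mx R n l i \is a Num.int.
Proof. by rewrite mxE natr_int. Qed.

Lemma diff_mx_bij (R : realType) (n : nat) :
  set_bij (latticeZ R n) (latticeA R n) (mulmxr (diff_mx R n)).
Proof.
split=> [x xZ|x y _ _ /= xy|a [aZ a0]].
- split; first exact/latticeZ_mulmx/diff_mx_int.
  under eq_bigr => l _ do rewrite mxE.
  rewrite exchange_big big1 //= => i _; rewrite -mulr_sumr.
  under eq_bigr => l _ do rewrite mxE -[X in X - _]mulr1 -[X in _ - X]mulr1.
  rewrite sumrB !(sum_pick _ _ (fun=> 1)) !ltnS ltn_ord ltnW ?ltn_ord //.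
  by rewrite subrr mulr0.
- by rewrite -[x]mulmx1 -[y]mulmx1 -(mul_diff_tail R n) !mulmxA xy.
- exists (a *m tail_mx R n); first exact/latticeZ_mulmx/tail_mx_int.
  rewrite /= -mulmxA mul_tail_diff mulmxBr mulmx1.
  rewrite [X in a - X](_ : _ = 0) ?subr0 //.
  apply/rowP => k; rewrite !mxE.
  by under eq_bigr => l _ do rewrite mxE; rewrite -mulr_suml a0 mul0r.
Qed.

(** * The factors of the two polynomials *)

(** Indexing basis vectors by natural numbers keeps e_(m+1) - e_m in the form
required for telescoping. *)
Definition unit_row (R : realType) (n k : nat) : 'rV[R]_n :=
  \row_l (l == k :> nat)%:R.

Lemma exponentU (R : realType) (n : nat) (i : 'I_n) :
  exponent R U_(i)%MM = unit_row R n i.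
Proof. by apply/rowP => l; rewrite !mxE mnm1E -val_eqE eq_sym. Qed.

Lemma exponent_sum (R : realType) (n : nat) (I : finType) (P : pred I)
    (F : I -> 'X_{1..n}) :
  exponent R (\sum_(i | P i) F i)%MM = \sum_(i | P i) exponent R (F i).
Proof.
apply/rowP => l; rewrite summxE mxE mnm_sumE natr_sum.
by apply: eq_bigr => i _; rewrite mxE.
Qed.

Lemma unit_row_diff (R : realType) (n : nat) (i : 'I_n) :
  unit_row R n i *m diff_mx R n = unit_row R n.+1 i.+1 - unit_row R n.+1 i.
Proof.
apply/rowP => l; rewrite !mxE (bigD1 i) //= big1 ?addr0 => [|k ki].
  by rewrite !mxE eqxx mul1r.
by rewrite mxE (negPf (ki : k != i :> nat)) mul0r.
Qed.

(** This is t_i + ... + t_j = t_i * q_(j-i, i+1)(y), monomial by monomial: the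
l-th summand y_(i+1) ... y_(i+l) corresponds to t_(i+l) / t_i by telescoping,
and the translation by e_i accounts for the factor t_i. *)
Lemma affinely_related_factor (R : realType) (n i j : nat) :
  (i <= j <= n)%N ->
  affinely_related (mulmxr (diff_mx R n)) (unit_row R n.+1 i)
    (q R n (j - i) i.+1) (\sum_(l < n.+1 | (i <= l <= j)%N) 'X_l).
Proof.
move=> /andP[ij jn].
have -> : \sum_(l < n.+1 | (i <= l <= j)%N) ('X_l : {mpoly R[n.+1]}) =
    \sum_(l < (j - i).+1) 'X_(inord (l + i)).
  (* Shift the summation index so that both sums run over l < j - i + 1. *)
  rewrite -subSn // -(big_mkord xpredT (fun l => 'X_(inord (l + i)))).
  rewrite -(big_addn 0 j.+1 i xpredT (fun l => 'X_(inord l))).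
  rewrite (big_nat_widen _ _ n.+1) //= add0n.
  rewrite big_geq_mkord; apply: eq_big => [l|l _]; last by rewrite inord_val.
  by rewrite ltnS andbC.
apply: big_ind2 => [||l _]; first exact: affinely_related0.
  by move=> *; apply: affinely_relatedD.
have lin : (i + l <= n)%N by have := ltn_ord l; lia.
rewrite mprodXE; apply: affinely_relatedX.
rewrite exponentU exponent_sum inordK; last by lia.
rewrite linear_sum.
under eq_bigr => m _ do rewrite /= exponentU unit_row_diff.
have -> : \sum_(m < n | (i < m.+1 < i.+1 + l)%N)
      (unit_row R n.+1 m.+1 - unit_row R n.+1 m) =
    \sum_(i <= m < i + l) (unit_row R n.+1 m.+1 - unit_row R n.+1 m).
  rewrite (big_nat_widen _ _ n) // big_geq_mkord.
  by apply: eq_bigl => m; rewrite /= addSn !ltnS andbC.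
by rewrite telescope_sumr ?leq_addr // subrK addnC.
Qed.

(** Passing from (length, start) to (start, end) coordinates on intervals.  The
right-hand side also contains the intervals of length 0, contributing 1. *)
Lemma prod_triangle (A : comPzSemiRingType) (n : nat) (F : nat -> nat -> A) :
  (forall j, F 0 j = 1) ->
  \prod_(1 <= k < n.+1) \prod_(1 <= j < (n - k + 1).+1) F k j =
  \prod_(i < n.+1) \prod_(j < n.+1 | (i <= j)%N) F (j - i)%N i.+1.
Proof.
move=> F0.
transitivity (\prod_(k < n.+1) \prod_(i < n.+1 | (i + k <= n)%N) F k i.+1).
  rewrite [RHS]big_ord_recl [X in X * _]big1 // mul1r big_add1 big_mkord.
  apply: eq_bigr => k _; rewrite big_add1 big_mkord.
  rewrite (big_ord_widen n.+1 (fun i => F k.+1 i.+1)) /=; last first.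
    by have := ltn_ord k; lia.
  by apply: eq_bigl => i; have := ltn_ord k; rewrite /bump /=; lia.
rewrite (exchange_big_dep xpredT) //=; apply: eq_bigr => i _.
have -> : \prod_(j < n.+1 | (i <= j)%N) F (j - i)%N i.+1 =
    \prod_(0 <= k < n.+1 - i) F k i.+1.
  rewrite (eq_bigr (fun k => F (k + i - i)%N i.+1)); last first.
    by move=> k _; rewrite addnK.
  rewrite -(big_addn 0 n.+1 i xpredT (fun j => F (j - i)%N i.+1)).
  by rewrite add0n big_geq_mkord.
rewrite big_mkord (big_ord_widen n.+1 (fun k => F k i.+1)) ?leq_subr //.
by apply: eq_bigl => k; rewrite /=; have := ltn_ord i; lia.
Qed.

(** * The equivalence *)

Theorem corollary3p6 (R : realType) (n : nat) (hn : (1 <= n)%N) :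
  exists w : 'rV[R]_n.+1,
    latticeZ R n.+1 w /\
    unimodularly_equivalent (latticeZ R n) (latticeA R n)
      (catalan_pellytope R n) (translate w (Ass R n)).
Proof.
pose f : {linear 'rV[R]_n -> 'rV[R]_n.+1} := mulmxr (diff_mx R n).
pose c : 'rV[R]_n.+1 :=
  \sum_(i < n.+1) \sum_(j < n.+1 | (i <= j)%N) unit_row R n.+1 i.
set pC := \prod_(1 <= k < n.+1) \prod_(1 <= j < (n - k + 1).+1) q R n k j.
have [_ _ expE] : affinely_related f c pC
    (\prod_(i < n.+1) \prod_(j < n.+1 | (i <= j)%N)
          \sum_(l < n.+1 | (i <= l <= j)%N) 'X_l).
  rewrite /pC prod_triangle => [|j]; last first.
    by rewrite /q big_ord1 big_pred0 // => i; rewrite addn0; lia.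
  apply: big_ind3 => [||i _]; first exact: affinely_related1.
    by move=> *; apply: affinely_relatedM.
  apply: big_ind3 => [||j ij]; first exact: affinely_related1.
    by move=> *; apply: affinely_relatedM.
  by apply: affinely_related_factor; rewrite ij -ltnS ltn_ord.
have AssE : translate (- c) (Ass R n) = f @` catalan_pellytope R n.
  rewrite /Ass /Newt -/(exponents _) expE conv_hull_affine /translate.
  rewrite image_comp; apply: eq_imagel => x _ /=.
  by rewrite addrK.
have expZ : exponents pC `<=` latticeZ R n.
  by move=> _ [m _ <-] i; rewrite mxE natr_int.
have [fZ _ _] := @diff_mx_bij R n.
exists (- c); split.
  move=> l; rewrite mxE rpredN summxE rpred_sum // => i _.
  by rewrite summxE rpred_sum // => j _; rewrite mxE natr_int.
split.
- exists (exponents pC); split=> //.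
  by apply: finite_image; apply: finite_seq.
- exists (f @` exponents pC); split.
  + by apply/finite_image/finite_image/finite_seq.
  + by move=> _ [x /expZ xZ <-]; apply: fZ.
  + rewrite AssE.
    have f0 A : [set f x + 0 | x in A] = f @` A.
      by apply: eq_imagel => x _; rewrite addr0.
    by have := conv_hull_affine f 0 (exponents pC); rewrite !f0 => ->.
- exists f, 0; split; first exact: diff_mx_bij.
    by split=> [i|]; [|rewrite big1 // => i _]; rewrite mxE.
  rewrite AssE /translate -[LHS]image_id; apply: eq_imagel => x _.
  by rewrite addr0.
Qed.
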